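(* Let $(A,\mathfrak{m})$ be a Noetherian local ring and let $\mathfrak{a}$ be an $\mathfrak{m}$-primary ideal. Let $M$ be a Cohen-Macaulay $A$-module of dimension $r\ge 2$ and let $\mathcal{F}=\{M_n\}_{n\in\mathbb{Z}}$ be an $\mathfrak{a}$-stable filtration on $M$ with $M_n=M$ for $n\le 0$. Let $\mathfrak{M}$ be the maximal homogeneous ideal of the Rees algebra $\mathcal{S}_{\mathfrak{a}}(A)$ and let $H^i_{\mathfrak{M}}(-)$ denote the $i$-th local cohomology functor with respect to $\mathfrak{M}$. If $\operatorname{depth}G_{\mathcal{F}^{<m>}}(M)\ge 2$ for some $m\ge 1$, then $H^1_{\mathfrak{M}}(L^{\mathcal{F}}(M))_n=0$ for $n<0$.
   Context: Modules are finitely generated unless stated otherwise. An $\mathfrak{a}$-stable filtration on $M$ is a family $\mathcal{F}=\{M_n\}_{n\in\mathbb{Z}}$ of submodules with $M_n\supseteq M_{n+1}$ for all $n$, $M_n=M$ for $n\ll 0$, $\mathfrak{a}M_n\subseteq M_{n+1}$ for all $n$, and $\mathfrak{a}M_n=M_{n+1}$ for all $n\gg 0$. $\mathcal{S}_{\mathfrak{a}}(A)=A[\mathfrak{a}t]=\bigoplus_{n\ge 0}\mathfrak{a}^n t^n$ is the Rees algebra, and $\mathfrak{M}=\mathfrak{m}\oplus\mathcal{S}_{\mathfrak{a}}(A)_+$. Put $L^{\mathcal{F}}(M)=\bigoplus_{n\ge 0}M/M_{n+1}$ (degree $n$ component $M/M_{n+1}$). With $\mathcal{S}(\mathcal{F},M)=\bigoplus_{n\ge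 0}M_n t^n\subseteq M[t]$ the Rees module, one has $M[t]/\mathcal{S}(\mathcal{F},M)=L^{\mathcal{F}}(M)(-1)$, and this gives $L^{\mathcal{F}}(M)$ its structure of a graded $\mathcal{S}_{\mathfrak{a}}(A)$-module (in general not finitely generated). For $m\ge 1$, $\mathcal{F}^{<m>}=\{M_{nm}\}_{n\in\mathbb{Z}}$ (an $\mathfrak{a}^m$-stable filtration) and $G_{\mathcal{F}^{<m>}}(M)=\bigoplus_{n\in\mathbb{Z}}M_{nm}/M_{(n+1)m}$, a finitely generated graded module over $G_{\mathfrak{a}^m}(A)=\bigoplus_{n\ge0}\mathfrak{a}^{nm}/\mathfrak{a}^{(n+1)m}$; its depth is taken with respect to the homogeneous maximal ideal of $G_{\mathfrak{a}^m}(A)$. *)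

(* Defs.v *)
From HB Require Import structures.
From mathcomp Require Import all_boot all_order all_algebra.
From mathcomp Require Import all_classical.
From mathcomp Require Import zify.

Set Implicit Arguments.
Unset Strict Implicit.
Unset Printing Implicit Defensive.

Import Order.TTheory GRing.Theory Num.Theory.
Local Open Scope classical_set_scope.
Local Open Scope quotient_scope.
Local Open Scope ring_scope.


Definition submodule (R : pzRingType) (V : lmodType R) (N : set V) : Prop :=
  submod_closed (fun x => x \in N).

Definition ideal (R : comPzRingType) (I : set R) : Prop :=
  @submodule R R^o I.

(* All finite sums of products r *: x with r in I and x in N; this is the
   submodule generated by these products as soon as I or N is one. *)
Definition smul (R : pzRingType) (V : lmodType R) (I : set R) (N : set V) :
    set V :=
  [set x | exists2 s : seq (R * V),
     {in s, forall p, I p.1 /\ N p.2} & x = \sum_(p <- s) p.1 *: p.2].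

Definition ipow (R : pzRingType) (I : set R) (n : nat) : set R :=
  iter n (@smul R R^o I) setT.

Definition span (R : pzRingType) (V : lmodType R) (s : seq V) : set V :=
  [set x | exists c : V -> R, x = \sum_(v <- s) c v *: v].

Definition fin_gen (R : pzRingType) (V : lmodType R) : Prop :=
  exists s : seq V, span s = setT.

Definition annihilator (R : pzRingType) (V : lmodType R) : set R :=
  [set r | forall x : V, r *: x = 0].

Section CommutativeAlgebra.
Variable A : comPzRingType.
Implicit Types I m : set A.

Definition noetherian : Prop :=
  forall I, ideal I -> exists s : seq A^o, I = span s.

Definition maximal_ideal m : Prop :=
  [/\ ideal m, ~ m 1 & forall I, ideal I -> ~ I 1 -> m `<=` I -> I = m].

Definition local_ring m : Prop :=
  maximal_ideal m /\ forall n, maximal_ideal n -> n = m.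

Definition radical I : set A := [set x | exists n : nat, I (x ^+ n)].

Definition prime_ideal I : Prop :=
  [/\ ideal I, ~ I 1 & forall x y, I (x * y) -> I x \/ I y].

Definition primary_ideal I : Prop :=
  [/\ ideal I, ~ I 1 & forall x y, I (x * y) -> I x \/ radical I y].

(* I is m-primary. *)
Definition primary_to m I : Prop := primary_ideal I /\ radical I = m.

(* A strictly increasing chain P 0, ..., P d of primes containing I. *)
Definition prime_chain I (d : nat) : Prop :=
  exists P : nat -> set A,
    (forall i, (i <= d)%N -> prime_ideal (P i) /\ I `<=` P i) /\
    (forall i, (i < d)%N -> P i `<` P i.+1).

(* The Krull dimension of A / Ann M is d; for a finitely generated M this is
   the dimension of its support. *)
Definition has_dim (M : lmodType A) (d : nat) : Prop :=
  prime_chain (annihilator M) d /\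
  forall e, prime_chain (annihilator M) e -> (e <= d)%N.

(* [set` take i xs] is the set of the first i elements, so that the i-th
   condition says that xs`_i is a nonzerodivisor on M / (xs_0..xs_(i-1)) M. *)
Definition regular_seq (M : lmodType A) (xs : seq A) : Prop :=
  (forall i, (i < size xs)%N -> forall y : M,
     smul [set` take i xs] setT (xs`_i *: y) -> smul [set` take i xs] setT y) /\
  smul [set` xs] setT <> [set: M].

(* depth_I M >= d, the depth being the supremum of the lengths of the
   M-regular sequences in I. *)
Definition depth_ge I (M : lmodType A) (d : nat) : Prop :=
  exists xs : seq A,
    [/\ {in xs, forall x, I x}, regular_seq M xs & (d <= size xs)%N].

Definition has_depth I (M : lmodType A) (d : nat) : Prop :=
  depth_ge I M d /\ forall e, depth_ge I M e -> (e <= d)%N.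

(* M is a (nonzero) Cohen-Macaulay module over the local ring (A, m). *)
Definition cohen_macaulay m (M : lmodType A) : Prop :=
  fin_gen M /\ exists2 d, has_dim M d & has_depth m M d.

End CommutativeAlgebra.

Section SubmoduleTheory.
Variables (R : pzRingType) (V : lmodType R) (N : set V).
Hypothesis N_sub : submodule N.

Lemma submod0 : N 0. Proof. by case: N_sub => /set_mem. Qed.

Lemma submodZD a x y : N x -> N y -> N (a *: x + y).
Proof. by case: N_sub => _ h Nx Ny; apply/set_mem/h; apply/mem_set. Qed.

Lemma submodD x y : N x -> N y -> N (x + y).
Proof. by move=> Nx Ny; rewrite -[x]scale1r; apply: submodZD. Qed.

Lemma submodZ a x : N x -> N (a *: x).
Proof. by move=> Nx; rewrite -[_ *: _]addr0; apply/submodZD/submod0. Qed.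

Lemma submodB x y : N x -> N y -> N (x - y).
Proof. by move=> Nx Ny; apply: submodD => //; rewrite -scaleN1r; apply: submodZ. Qed.

Lemma submod_sum (J : Type) (r : seq J) (P : pred J) (F : J -> V) :
  (forall j, P j -> N (F j)) -> N (\sum_(j <- r | P j) F j).
Proof.
by move=> h; elim/big_ind: _ => //; [exact: submod0|exact: submodD].
Qed.

Lemma submod_sum_seq (J : eqType) (r : seq J) (F : J -> V) :
  {in r, forall j, N (F j)} -> N (\sum_(j <- r) F j).
Proof. by move=> h; rewrite big_seq; apply: submod_sum. Qed.

End SubmoduleTheory.

Lemma submoduleI (R : pzRingType) (V : lmodType R) (N : set V) :
  N 0 -> (forall a x y, N x -> N y -> N (a *: x + y)) -> submodule N.
Proof.
move=> N0 h; split=> [|a x y /set_mem Nx /set_mem Ny]; apply/mem_set => //.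
exact: h.
Qed.

Lemma smulM (R : pzRingType) (V : lmodType R) (I : set R) (N : set V) r x :
  I r -> N x -> smul I N (r *: x).
Proof.
move=> Ir Nx; exists [:: (r, x)]; last by rewrite big_seq1.
by move=> p; rewrite inE => /eqP ->.
Qed.

Lemma smul_submodule (R : comPzRingType) (V : lmodType R) (I : set R)
  (N : set V) : submodule N -> submodule (smul I N).
Proof.
move=> Ns; apply: submoduleI; first by exists [::]; rewrite ?big_nil.
move=> a _ _ [s hs ->] [t ht ->].
exists ([seq (p.1, a *: p.2) | p <- s] ++ t).
  move=> p; rewrite mem_cat => /orP[/mapP[q /hs[Iq Nq] ->]|/ht//].
  by split=> //=; apply: submodZ.
rewrite big_cat big_map /= scaler_sumr; congr (_ + _).
by apply: eq_bigr => p _; rewrite !scalerA mulrC.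
Qed.

Lemma smulS (R : pzRingType) (V : lmodType R) (I : set R) (N N' : set V) :
  submodule N' -> (forall r x, I r -> N x -> N' (r *: x)) -> smul I N `<=` N'.
Proof.
move=> N's h _ [s hs ->]; apply: submod_sum_seq => // p /hs[]; exact: h.
Qed.

Lemma ipow_ideal (R : comPzRingType) (I : set R) n : ideal (ipow I n).
Proof.
elim: n => [|n IH]; first by apply: submoduleI.
exact: (@smul_submodule R R^o).
Qed.


Record submod (R : pzRingType) (V : lmodType R) := Submod {
  submod_set :> set V;
  submodP : submodule submod_set }.

Definition submod_pred (R : pzRingType) (V : lmodType R) (N : submod V) :
  V -> bool := fun x => x \in submod_set N.

HB.instance Definition _ (R : pzRingType) (V : lmodType R) (N : submod V) :=
  GRing.isZmodClosed.Build V (submod_pred N) (GRing.submod_closedB (submodP N)).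

Definition submod_zmod (R : pzRingType) (V : lmodType R) (N : submod V) :
  zmodClosed V := GRing.ZmodClosed.clone V (submod_pred N) _.

Definition quotmod (R : pzRingType) (V : lmodType R) (N : submod V) : Type :=
  Quotient.quot (submod_zmod N).

Section QuotientModule.
Variables (R : pzRingType) (V : lmodType R) (N : submod V).

HB.instance Definition _ := GRing.Zmodule.on (quotmod N).

Definition quotmod_pi (x : V) : quotmod N := \pi_(Quotient.quot (submod_zmod N)) x.
Definition quotmod_repr (x : quotmod N) : V :=
  repr (x : Quotient.quot (submod_zmod N)).

Lemma quotmod_piP x y : quotmod_pi x = quotmod_pi y <-> submod_set N (x - y).
Proof.
split=> [/eqP|] h.
  by apply/set_mem; have := h; rewrite -(Quotient.idealrBE (submod_zmod N)).
apply/eqP; rewrite -(Quotient.idealrBE (submod_zmod N)); exact/mem_set.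
Qed.

Lemma quotmod_piB x y : quotmod_pi (x - y) = quotmod_pi x - quotmod_pi y.
Proof. exact: (raddfB (\pi_(Quotient.quot (submod_zmod N)))). Qed.

Lemma quotmod_piD x y : quotmod_pi (x + y) = quotmod_pi x + quotmod_pi y.
Proof. exact: (raddfD (\pi_(Quotient.quot (submod_zmod N)))). Qed.

Lemma quotmod_piK x : quotmod_pi (quotmod_repr x) = x.
Proof. exact: reprK. Qed.

Definition quotmod_scale (r : R) (x : quotmod N) : quotmod N :=
  quotmod_pi (r *: quotmod_repr x).

Lemma quotmod_scaleE r x : quotmod_scale r (quotmod_pi x) = quotmod_pi (r *: x).
Proof.
apply/quotmod_piP; rewrite -scalerBr; apply: submodZ; first exact: submodP.
exact/quotmod_piP/quotmod_piK.
Qed.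

Fact quotmod_scalerA a b x :
  quotmod_scale a (quotmod_scale b x) = quotmod_scale (a * b) x.
Proof. by rewrite -(quotmod_piK x) !quotmod_scaleE scalerA. Qed.

Fact quotmod_scale1 : left_id 1 quotmod_scale.
Proof. by move=> x; rewrite -(quotmod_piK x) !quotmod_scaleE scale1r. Qed.

Fact quotmod_scaleDr : right_distributive quotmod_scale +%R.
Proof.
move=> a x y; rewrite -(quotmod_piK x) -(quotmod_piK y).
by rewrite -quotmod_piD !quotmod_scaleE -quotmod_piD scalerDr.
Qed.

Fact quotmod_scaleDl x : {morph quotmod_scale^~ x : a b / a + b}.
Proof.
move=> a b; rewrite -(quotmod_piK x).
by rewrite !quotmod_scaleE -quotmod_piD scalerDl.
Qed.

HB.instance Definition _ := GRing.Zmodule_isLmodule.Build R (quotmod N)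
  quotmod_scalerA quotmod_scale1 quotmod_scaleDr quotmod_scaleDl.

Lemma quotmod_piZ r x : quotmod_pi (r *: x) = r *: quotmod_pi x.
Proof. by rewrite [RHS]quotmod_scaleE. Qed.

Fact quotmod_pi_linear : linear quotmod_pi.
Proof. by move=> r x y; rewrite quotmod_piD quotmod_piZ. Qed.

HB.instance Definition _ := GRing.isLinear.Build R V (quotmod N) _ quotmod_pi
  quotmod_pi_linear.

End QuotientModule.


Section Rees.
Variables (A : comNzRingType) (a : set A).

Lemma ipowM i j x y : ipow a i x -> ipow a j y -> ipow a (i + j) (x * y).
Proof.
move=> + yj; elim: i x => [|i IH] x.
  by move=> _; exact: (submodZ (ipow_ideal a j)).
case=> s hs ->; rewrite mulr_suml.
apply: (submod_sum_seq (ipow_ideal a (i.+1 + j))) => p /hs[ap ip].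
by rewrite -mulrA; apply: (@smulM A A^o) => //; apply: IH.
Qed.

Definition rees_pred : {poly A} -> bool :=
  fun p : {poly A} => `[< forall i, ipow a i p`_i >].

Lemma rees_predP (p : {poly A}) : reflect (forall i, ipow a i p`_i) (p \in rees_pred).
Proof. exact: asboolP. Qed.

Fact rees_subring : subring_closed rees_pred.
Proof.
split=> [|p q /rees_predP hp /rees_predP hq|p q /rees_predP hp /rees_predP hq];
  apply/rees_predP => i.
- rewrite coef1; case: i => [//|i].
  exact: (submod0 (ipow_ideal a i.+1)).
- by rewrite coefB; apply: (submodB (ipow_ideal a i)).
- rewrite coefM; apply: (submod_sum (ipow_ideal a i)) => j _.
  have {1}-> : i = (j + (i - j))%N by have := ltn_ord j; lia.
  exact: ipowM.
Qed.
HB.instance Definition _ :=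
  GRing.isSubringClosed.Build {poly A} rees_pred rees_subring.

(* S_a(A) = A[at], as the polynomials whose i-th coefficient lies in a^i. *)
Record rees := Rees { rees_val :> {poly A}; _ : rees_val \in rees_pred }.

HB.instance Definition _ := [isSub of rees for rees_val].
HB.instance Definition _ := [Choice of rees by <:].
HB.instance Definition _ := [SubChoice_isSubComNzRing of rees by <:].

Lemma rees_coef (p : rees) i : ipow a i (rees_val p)`_i.
Proof. by move: i; apply/rees_predP; exact: (valP p). Qed.

Definition rees_part (n : int) : set rees :=
  [set p | forall i : nat, i%:Z <> n -> (rees_val p)`_i = 0].

(* m (+) S_a(A)_+ *)
Definition rees_max (m : set A) : set rees :=
  [set p | m (rees_val p)`_0].

(* The ideal a S_a(A) = (+)_n a^(n+1) t^n. *)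
Definition rees_next : set rees :=
  [set p | forall i, ipow a i.+1 (rees_val p)`_i].

Fact rees_next_ideal : ideal rees_next.
Proof.
apply: submoduleI => [i|p q r hq hr i].
  by rewrite coef0; apply: (submod0 (ipow_ideal a i.+1)).
rewrite coefD; apply: (submodD (ipow_ideal a i.+1)) => //.
rewrite coefM; apply: (submod_sum (ipow_ideal a i.+1)) => j _.
have {1}-> : i.+1 = (j + (i - j).+1)%N by have := ltn_ord j; lia.
by apply: ipowM => //; apply: rees_coef.
Qed.

Definition rees_next_submod : submod rees^o := Submod rees_next_ideal.

(* G_a(A) = (+)_n a^n / a^(n+1). *)
Definition gr_ring : Type := quotmod rees_next_submod.
HB.instance Definition _ := GRing.Zmodule.on gr_ring.

Definition gr_pi (p : rees) : gr_ring := quotmod_pi rees_next_submod p.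
Definition gr_repr (x : gr_ring) : rees :=
  @quotmod_repr _ _ rees_next_submod x.
Definition gr_mul (x y : gr_ring) : gr_ring := gr_pi (gr_repr x * gr_repr y).

Lemma gr_piK x : gr_pi (gr_repr x) = x.
Proof. exact: quotmod_piK. Qed.

Lemma gr_piD p q : gr_pi (p + q) = gr_pi p + gr_pi q.
Proof. exact: quotmod_piD. Qed.

Lemma gr_piP p q : gr_pi p = gr_pi q <-> rees_next (p - q).
Proof. exact: quotmod_piP. Qed.

Lemma gr_piM p q : gr_mul (gr_pi p) (gr_pi q) = gr_pi (p * q).
Proof.
apply/gr_piP; set p' := gr_repr _; set q' := gr_repr _.
have hp : rees_next (p' - p) by apply/gr_piP/gr_piK.
have hq : rees_next (q' - q) by apply/gr_piP/gr_piK.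
have -> : p' * q' - p * q = q' * (p' - p) + p * (q' - q).
  by rewrite !mulrBr [q' * p']mulrC [q' * p]mulrC addrA subrK.
by apply: (submodD rees_next_ideal); apply: (submodZ rees_next_ideal).
Qed.

Fact gr_mulA : associative gr_mul.
Proof.
move=> x y z; rewrite -(gr_piK x) -(gr_piK y) -(gr_piK z).
by rewrite !gr_piM mulrA.
Qed.
Fact gr_mulC : commutative gr_mul.
Proof. by move=> x y; rewrite /gr_mul mulrC. Qed.
Fact gr_mul1 : left_id (gr_pi 1) gr_mul.
Proof. by move=> x; rewrite -(gr_piK x) gr_piM mul1r. Qed.
Fact gr_mulDl : left_distributive gr_mul +%R.
Proof.
move=> x y z; rewrite -(gr_piK x) -(gr_piK y) -(gr_piK z).
by rewrite -gr_piD !gr_piM -gr_piD mulrDl.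
Qed.

HB.instance Definition _ := GRing.Zmodule_isComPzRing.Build gr_ring
  gr_mulA gr_mulC gr_mul1 gr_mulDl.

(* m / a (+) G_a(A)_+ *)
Definition gr_max (m : set A) : set gr_ring := gr_pi @` rees_max m.

End Rees.

Arguments rees_part {A} a n _.
Arguments rees_max {A} a m _.
Arguments rees_next {A} a _.
Arguments gr_max {A} a m _.


(* A family of submodules F n with a F_n contained in F_(n+1); it need not be
   decreasing. *)
Record afamily (A : comNzRingType) (a : set A) (M : lmodType A) := AFamily {
  afam :> int -> set M;
  afam_sub : forall n, submodule (afam n);
  afam_mul : forall n, smul a (afam n) `<=` afam (n + 1) }.

Definition stable_filtration (A : comNzRingType) (a : set A) (M : lmodType A)
    (F : afamily a M) : Prop :=
  [/\ forall n, F (n + 1) `<=` F n,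
      exists n0, forall n, n <= n0 -> F n = setT &
      exists n0, forall n, n0 <= n -> smul a (F n) = F (n + 1)].

Section Families.
Variables (A : comNzRingType) (a : set A) (M : lmodType A).
Implicit Type F : afamily a M.

Lemma afam_ipow F i c n x : ipow a i c -> F n x -> F (n + i%:Z) (c *: x).
Proof.
move=> + Fx; elim: i c => [|i IH] c.
  by move=> _; rewrite addr0; apply: (submodZ (afam_sub F n)).
case=> s hs ->; rewrite scaler_suml.
apply: (submod_sum_seq (afam_sub F _)) => p /hs[ap ip].
have -> : n + i.+1%:Z = (n + i%:Z) + 1 by lia.
by rewrite -scalerA; apply/afam_mul/smulM => //; apply: IH.
Qed.

Definition afam_top : afamily a M.
Proof. by exists (fun=> setT) => // n; apply: submoduleI. Defined.

Definition afam_shift F (k : int) : afamily a M.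
Proof.
exists (fun n => F (n + k)) => n; first exact: afam_sub.
by rewrite addrAC; apply: afam_mul.
Defined.

(* The part of a family sitting in degrees >= 0. *)
Definition afam_nonneg F : afamily a M.
Proof.
exists (fun n => if 0 <= n then F n else [set 0]) => n.
  by case: ifP => _; [exact: afam_sub|apply: submoduleI => // c x y -> ->;
    rewrite scaler0 addr0].
case: ifP => n0.
  by rewrite (_ : 0 <= n + 1); [exact: afam_mul|lia].
apply: smulS => [|r x _ ->]; last rewrite scaler0.
  by case: ifP => _; [exact: afam_sub|apply: submoduleI => // c x y -> ->;
    rewrite scaler0 addr0].
by case: ifP => _ //; apply: (submod0 (afam_sub F _)).
Defined.

(* F^<m> = (F_(nm))_n, a family for the ideal a^m. *)
Definition veronese F (m : nat) : afamily (ipow a m) M.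
Proof.
exists (fun n => F (n * m%:Z)) => n; first exact: afam_sub.
apply: smulS => [|r x ar Fx]; first exact: afam_sub.
by rewrite mulrDl mul1r; apply: afam_ipow.
Defined.

End Families.

Section PolyAction.
Variables (A : comNzRingType) (M : lmodType A).
Implicit Types (p q : {poly A}) (f g : int -> M).

(* The action of A[t] on the M-valued functions on the integers, where f stands
   for the formal sum of the f n t^n. *)
Definition pact p f : int -> M :=
  fun n => \sum_(i < size p) p`_i *: f (n - i%:Z).

Lemma pact_wide N p f n : (size p <= N)%N ->
  pact p f n = \sum_(i < N) p`_i *: f (n - i%:Z).
Proof.
move=> le; rewrite /pact (big_ord_widen N (fun i => p`_i *: f (n - i%:Z))) //.
rewrite big_mkcond /=; apply: eq_bigr => i _; case: ltnP => // h.
by rewrite nth_default // scale0r.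
Qed.

Lemma pactDl p q f : pact (p + q) f = pact p f + pact q f.
Proof.
apply/funext => n; rewrite [RHS]/GRing.add /=.
rewrite !(@pact_wide (maxn (size p) (size q))) ?leq_maxl ?leq_maxr //; last first.
  exact: size_polyD.
by rewrite -big_split; apply: eq_bigr => i _; rewrite coefD scalerDl.
Qed.

Lemma pactDr p f g : pact p (f + g) = pact p f + pact p g.
Proof.
apply/funext => n; rewrite [RHS]/GRing.add /= /pact -big_split.
by apply: eq_bigr => i _; exact: scalerDr.
Qed.

Lemma pactC c f : pact c%:P f = c *: f.
Proof.
apply/funext => n; rewrite (@pact_wide 1) ?size_polyC ?leq_b1 //.
by rewrite big_ord1 coefC /= subr0.
Qed.

Lemma pact_mulX p f n : pact (p * 'X) f n = pact p f (n - 1).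
Proof.
rewrite (@pact_wide (size p).+1); last first.
  by apply: leq_trans (size_polyMleq _ _) _; rewrite size_polyX addn2.
rewrite big_ord_recl coefMX /= scale0r add0r; apply: eq_bigr => i _.
by rewrite coefMX /=; congr (_ *: f _); rewrite /bump; lia.
Qed.

Lemma pactZl p c f : pact (c *: p) f = c *: pact p f.
Proof.
apply/funext => n; rewrite (@pact_wide (size p)) ?size_scale_leq //.
rewrite /pact [RHS]/GRing.scale /= scaler_sumr.
by apply: eq_bigr => i _; rewrite coefZ scalerA.
Qed.

Lemma pactM p q f : pact (p * q) f = pact p (pact q f).
Proof.
elim/poly_ind: p => [|p c IH]; first by rewrite mul0r -polyC0 !pactC !scale0r.
rewrite mulrDl !pactDl mul_polyC; congr (_ + _).
  by apply/funext => n; rewrite -mulrA ['X * q]mulrC mulrA !pact_mulX IH.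
by rewrite pactC pactZl.
Qed.

End PolyAction.

Section ReesModule.
Variables (A : comNzRingType) (a : set A) (M : lmodType A).
Variable F : afamily a M.
Implicit Types p : rees a.

Definition reesmod_pred : (int -> M) -> bool := fun f =>
  `[< (exists s : seq int, forall n, n \notin s -> f n = 0) /\
      forall n, F n (f n) >].

Lemma reesmod_predP (f : int -> M) : reflect
  ((exists s : seq int, forall n, n \notin s -> f n = 0) /\ forall n, F n (f n))
  (f \in reesmod_pred).
Proof. exact: asboolP. Qed.

Fact reesmod_zmod_closed : zmod_closed reesmod_pred.
Proof.
split=> [|f g /reesmod_predP[[s fs] fF] /reesmod_predP[[t gt] gF]];
  apply/reesmod_predP; split.
- by exists [::].
- by move=> n; apply: (submod0 (afam_sub F n)).
- exists (s ++ t) => n; rewrite mem_cat negb_or => /andP[ns nt].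
  by rewrite /GRing.opp /GRing.add /= fs // gt // subr0.
- by move=> n; apply: (submodB (afam_sub F n)).
Qed.
HB.instance Definition _ :=
  GRing.isZmodClosed.Build (int -> M) reesmod_pred reesmod_zmod_closed.

(* The S_a(A)-module of the finite sums of terms x t^n with n an integer and x
   in F n; the term x t^n is the function with value x at n and 0 elsewhere. *)
Record reesmod := Reesmod {
  reesmod_val :> int -> M; _ : reesmod_val \in reesmod_pred }.

HB.instance Definition _ := [isSub of reesmod for reesmod_val].
HB.instance Definition _ := [Choice of reesmod by <:].
HB.instance Definition _ := [SubChoice_isSubZmodule of reesmod by <:].

Lemma reesmod_coef (f : reesmod) n : F n (reesmod_val f n).
Proof. by case/reesmod_predP: (valP f). Qed.

Fact reesmod_scale_subproof p (f : reesmod) :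
  pact (rees_val p) (reesmod_val f) \in reesmod_pred.
Proof.
case/reesmod_predP: (valP f) => -[s fs] fF; apply/reesmod_predP; split.
  exists [seq n + i%:Z | n <- s, i <- iota 0 (size (rees_val p))] => n hn.
  rewrite /pact big1 // => i _; rewrite [reesmod_val f _]fs ?scaler0 //.
  apply: contra hn => hn; apply/allpairsP; exists (n - i%:Z, val i) => /=.
  by rewrite mem_iota /= ltn_ord subrK.
move=> n; apply: (submod_sum (afam_sub F n)) => i _.
rewrite -{1}[n](subrK i%:Z); apply: afam_ipow; [exact: rees_coef|exact: fF].
Qed.

Definition reesmod_scale p (f : reesmod) : reesmod :=
  Reesmod (reesmod_scale_subproof p f).

Fact reesmod_scalerA p q f :
  reesmod_scale p (reesmod_scale q f) = reesmod_scale (p * q) f.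
Proof. by apply: val_inj; rewrite /= -pactM. Qed.
Fact reesmod_scale1 : left_id 1 reesmod_scale.
Proof. by move=> f; apply: val_inj; rewrite /= -polyC1 pactC scale1r. Qed.
Fact reesmod_scaleDr : right_distributive reesmod_scale +%R.
Proof. by move=> p f g; apply: val_inj; rewrite /= -pactDr. Qed.
Fact reesmod_scaleDl f : {morph reesmod_scale^~ f : p q / p + q}.
Proof. by move=> p q; apply: val_inj; rewrite /= -pactDl. Qed.

HB.instance Definition _ := GRing.Zmodule_isLmodule.Build (rees a) reesmod
  reesmod_scalerA reesmod_scale1 reesmod_scaleDr reesmod_scaleDl.

End ReesModule.

Section Subquotient.
Variables (A : comNzRingType) (a : set A) (M : lmodType A).
Variables P Q : afamily a M.

Definition subquot_rel : set (reesmod P) :=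
  [set f | forall n, Q n (reesmod_val f n)].

Fact subquot_rel_submodule : submodule subquot_rel.
Proof.
apply: submoduleI => [n|p f g hf hg n]; first exact: (submod0 (afam_sub Q n)).
apply: (submodD (afam_sub Q n)) => //=; rewrite /pact.
apply: (submod_sum (afam_sub Q n)) => i _.
rewrite -{1}[n](subrK i%:Z); apply: afam_ipow; [exact: rees_coef|exact: hf].
Qed.

(* The S_a(A)-module (+)_n P_n / (P_n :&: Q_n). *)
Definition subquot : Type := quotmod (Submod subquot_rel_submodule).
HB.instance Definition _ := GRing.Lmodule.on subquot.

Definition subquot_pi (f : reesmod P) : subquot :=
  quotmod_pi (Submod subquot_rel_submodule) f.

Definition subquot_repr (x : subquot) : reesmod P :=
  @quotmod_repr _ _ (Submod subquot_rel_submodule) x.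

Lemma subquot_piK x : subquot_pi (subquot_repr x) = x.
Proof. exact: quotmod_piK. Qed.

Fact subquot_pi_linear : linear subquot_pi.
Proof. exact: quotmod_pi_linear. Qed.

HB.instance Definition _ := GRing.isLinear.Build (rees a) (reesmod P) subquot _
  subquot_pi subquot_pi_linear.

Lemma subquot_pi0 f : subquot_pi f = 0 <-> subquot_rel f.
Proof.
by rewrite -[0](raddf0 subquot_pi); split=> [/quotmod_piP|h];
  [rewrite subr0|apply/quotmod_piP; rewrite subr0].
Qed.

Definition subquot_part (n : int) : set subquot :=
  subquot_pi @` [set f | forall k, k <> n -> reesmod_val f k = 0].

End Subquotient.

Section AssociatedGraded.
Variables (A : comNzRingType) (a : set A) (M : lmodType A).
Variable F : afamily a M.

(* G_F(M) = (+)_n F_n / F_(n+1), with its structure of G_a(A)-module. *)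
Definition gr_mod : Type := subquot F (afam_shift F 1).
HB.instance Definition _ := GRing.Zmodule.on gr_mod.

Definition gr_scale (x : gr_ring a) (u : gr_mod) : gr_mod :=
  gr_repr x *: (u : subquot F (afam_shift F 1)).

Lemma gr_scaleE p u :
  gr_scale (gr_pi p) u = p *: (u : subquot F (afam_shift F 1)).
Proof.
apply/eqP; rewrite -subr_eq0 /gr_scale -scalerBl -(subquot_piK u) -linearZ.
apply/eqP/subquot_pi0 => n /=; rewrite /pact.
apply: (submod_sum (afam_sub F _)) => i _.
have -> : n + 1 = (n - i%:Z) + i.+1%:Z by lia.
apply: afam_ipow; last exact: reesmod_coef.
have /gr_piP h : gr_pi (gr_repr (gr_pi p)) = gr_pi p by exact: gr_piK.
exact: h.
Qed.

Fact gr_scalerA x y u : gr_scale x (gr_scale y u) = gr_scale (x * y) u.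
Proof.
by rewrite -(gr_piK x) -(gr_piK y) [_ * _]gr_piM !gr_scaleE scalerA.
Qed.
Fact gr_scale1 : left_id 1 gr_scale.
Proof. by move=> u; rewrite [LHS]gr_scaleE scale1r. Qed.
Fact gr_scaleDr : right_distributive gr_scale +%R.
Proof. by move=> x u v; rewrite /gr_scale [LHS]scalerDr. Qed.
Fact gr_scaleDl u : {morph gr_scale^~ u : x y / x + y}.
Proof.
move=> x y; rewrite -(gr_piK x) -(gr_piK y) -gr_piD !gr_scaleE.
exact: scalerDl.
Qed.

HB.instance Definition _ := GRing.Zmodule_isLmodule.Build (gr_ring a) gr_mod
  gr_scalerA gr_scale1 gr_scaleDr gr_scaleDl.

End AssociatedGraded.


(* V is the direct sum of the subgroups g n. *)
Definition is_grading (V : zmodType) (g : int -> set V) : Prop :=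
  [/\ forall n, zmod_closed (fun x => x \in g n),
      forall x, exists s : seq int, exists2 c : int -> V,
        (forall n, g n (c n)) & x = \sum_(n <- s) c n &
      forall (s : seq int) (c : int -> V), uniq s -> (forall n, g n (c n)) ->
        \sum_(n <- s) c n = 0 -> {in s, forall n, c n = 0}].

Section Graded.
Variables (S : pzRingType) (Sg : int -> set S).

Record gmodule := GModule {
  gmod :> lmodType S;
  gpart : int -> set gmod;
  gpart_grading : is_grading gpart;
  gpart_scale : forall i j s x, Sg i s -> gpart j x -> gpart (i + j) (s *: x) }.

Definition ghom (X Y : gmodule) (f : X -> Y) : Prop :=
  linear f /\ forall n x, gpart n x -> gpart n (f x).

(* Injectivity in the category of graded S-modules and degree-preserving
   S-linear maps. *)
Definition ginjective (E : gmodule) : Prop :=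
  forall (X Y : gmodule) (i : X -> Y) (f : X -> E),
    ghom i -> injective i -> ghom f ->
    exists2 g : Y -> E, ghom g & forall x, g (i x) = f x.

(* 0 -> N -> E 0 -> E 1 -> ... is exact, with every E k injective. *)
Definition ginj_resolution (N : gmodule) (E : nat -> gmodule)
    (eps : N -> E 0%N) (d : forall k, E k -> E k.+1) : Prop :=
  [/\ forall k, ginjective (E k),
      ghom eps /\ forall k, ghom (d k),
      injective eps,
      forall x, d 0%N x = 0 <-> exists y, eps y = x &
      forall k x, d k.+1 x = 0 <-> exists y, d k y = x].

Definition torsion (I : set S) (V : lmodType S) : set V :=
  [set x | exists k : nat, forall s, ipow I k s -> s *: x = 0].

(* Given the coboundary maps d of a complex E, the set of the images in E k
   of the elements of degree n of Gamma_I(E (k-1)), with E (-1) = 0. *)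
Definition coboundary (I : set S) (E : nat -> gmodule)
    (d : forall k, E k -> E k.+1) (n : int) (k : nat) : set (E k) :=
  match k return set (E k) with
  | 0%N => [set 0]
  | j.+1 => d j @` [set y : E j | torsion I y /\ gpart n y]
  end.

(* H^k_I(N)_n = 0, where H^k_I is the k-th right derived functor of the
   I-torsion functor Gamma_I: for every injective resolution E of N in the
   category of graded S-modules, the k-th cohomology of Gamma_I(E) vanishes in
   degree n. The category has enough injectives, and the cohomology does not
   depend on the resolution. *)
Definition loc_coh_eq0 (I : set S) (N : gmodule) (k : nat) (n : int) : Prop :=
  forall (E : nat -> gmodule) (eps : N -> E 0%N) (d : forall j, E j -> E j.+1),
    ginj_resolution eps d ->
    forall x : E k, torsion I x -> gpart n x -> d k x = 0 ->
      coboundary I d n x.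

End Graded.

Section GradedSubquotient.
Variables (A : comNzRingType) (a : set A) (M : lmodType A).
Variables P Q : afamily a M.

Fact mono_subproof (f : reesmod P) (n : int) :
  (fun k => if k == n then reesmod_val f n else 0) \in reesmod_pred P.
Proof.
apply/reesmod_predP; split=> [|k]; last first.
  by case: eqP => [->|_]; [exact: reesmod_coef|exact: (submod0 (afam_sub P k))].
by exists [:: n] => k; rewrite inE => /negPf ->.
Qed.

Lemma reesmod_sumE (I : Type) (r : seq I) (f : I -> reesmod P) k :
  reesmod_val (\sum_(i <- r) f i) k = \sum_(i <- r) reesmod_val (f i) k.
Proof. by elim: r => [|i r IH]; rewrite ?big_nil // !big_cons -IH. Qed.

Fact subquot_grading : is_grading (@subquot_part _ _ _ P Q).
Proof.
split=> [n|x|s c us hc hs].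
- split; first by apply/mem_set; exists 0; rewrite ?raddf0.
  move=> _ _ /set_mem[f hf <-] /set_mem[g hg <-]; apply/mem_set.
  exists (f - g); last by rewrite raddfB.
  by move=> k kn; rewrite /= /GRing.add /GRing.opp /= hf // hg // subr0.
- set f := subquot_repr x; case/reesmod_predP: (valP f) => -[s fs] _.
  exists (undup s), (fun n => subquot_pi Q (Reesmod (mono_subproof f n))).
    move=> n; exists (Reesmod (mono_subproof f n)) => // k /eqP/negPf kn.
    by rewrite /= kn.
  rewrite -raddf_sum -[LHS]subquot_piK; congr subquot_pi; apply/val_inj/funext.
  move=> k; rewrite [RHS]reesmod_sumE /=; case: (boolP (k \in s)) => [ks|/fs k0].
    rewrite (bigD1_seq k) ?mem_undup ?undup_uniq //= eqxx big1 ?addr0 //.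
    by move=> n; rewrite eq_sym => /negPf ->.
  rewrite [LHS]k0 big1 // => n _; case: eqP => // <-; exact: k0.
- have /choice[f hf] : forall n, exists f : reesmod P,
      (forall k, k <> n -> reesmod_val f k = 0) /\ subquot_pi Q f = c n.
    by move=> n; have [f hf <-] := hc n; exists f.
  move=> n ns; have [fn <-] := hf n; apply/subquot_pi0 => k.
  have [->|/eqP/fn->] := eqVneq k n; last exact: (submod0 (afam_sub Q k)).
  have /subquot_pi0/(_ n) : subquot_pi Q (\sum_(i <- s) f i) = 0.
    rewrite raddf_sum -[RHS]hs; apply: eq_bigr => i _; exact: (hf i).2.
  rewrite reesmod_sumE (bigD1_seq n) //= big1 ?addr0 // => i /eqP ni.
  by apply: (hf i).1 => /esym.
Qed.

Fact subquot_part_scale i j (p : rees a) (x : subquot P Q) :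
  rees_part a i p -> subquot_part j x -> subquot_part (i + j) (p *: x).
Proof.
move=> hp [f hf <-]; exists (p *: f); last by rewrite linearZ.
move=> k kij; rewrite /= /pact big1 // => l _.
have [/eqP li|li] := boolP (l%:Z == i).
  by rewrite [reesmod_val _ _]hf ?scaler0 // => h; apply: kij; rewrite -h -li; lia.
by rewrite hp ?scale0r //; exact/eqP.
Qed.

Definition subquot_gmodule : gmodule (rees_part a) :=
  GModule subquot_grading subquot_part_scale.

End GradedSubquotient.

(* L^F(M) = (+)_(n >= 0) M / F_(n+1). For F_0 = M this is M[t] / S(F, M) shifted
   by one, and t^i in S_a(A) maps M / F_(n+1) to M / F_(n+i+1). *)
Definition Lmod (A : comNzRingType) (a : set A) (M : lmodType A)
    (F : afamily a M) : gmodule (rees_part a) :=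
  subquot_gmodule (afam_nonneg (afam_top a M)) (afam_nonneg (afam_shift F 1)).

(* Main.v *)
Require Import Defs.
From mathcomp Require Import all_boot all_order all_algebra.
From mathcomp Require Import all_classical.
From HB Require Import structures.
From mathcomp Require Import zify.

(* Idea. In negative degrees n a class in H^1(L) is represented by an element y
   of an injective module containing L with (S_+)^k y inside L, hence by maps
   phi_i : a^i -> M / F_(n+i+1), i >= k, with d phi_i(c) = c phi_j(d), and it
   has to be shown that phi_i = 0 for large i. Passing to the Veronese
   subalgebra (after multiplying by a suitable power of a t) one may replace F
   by F^<m>, so that the associated graded module G has depth >= 2.

   A G-regular sequence of length 2, not necessarily homogeneous, shows that
   compatible maps a^i -> G are multiplication by an element of G, which is 0
   in negative degrees. Hence phi vanishes as soon as its image in degree one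
   less does. This makes a class killed by a killed by a t as well, so it is 0
   because G has no torsion; and every class is killed by a power of a. *)

Set Implicit Arguments.
Unset Strict Implicit.
Unset Printing Implicit Defensive.

Import Order.TTheory GRing.Theory Num.Theory.
Local Open Scope classical_set_scope.
Local Open Scope ring_scope.

(** * Regular pairs and powers of ideals *)

Section RegularPair.
Variables (R : comPzRingType) (W : lmodType R).

(** The second condition is injectivity of [y] on W / xW, written without the quotient. *)
Definition regular_pair (x y : R) : Prop :=
  (forall w : W, x *: w = 0 -> w = 0) /\
  (forall w u : W, y *: w = x *: u -> exists v, w = x *: v).

(** Factors [y] are peeled off one at a time. For a single [y], an equation y w = x^(e+1) v gives w
    = x w', and cancelling x leaves y w' = x^e v. *)
Lemma regular_pairX x y e f :
  regular_pair x y -> regular_pair (x ^+ e) (y ^+ f).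
Proof.
case=> xreg yreg; split.
  by elim: e => [|e IH] w; rewrite ?expr0 ?scale1r // exprS -scalerA => /xreg/IH.
elim: f => [|f IHf] w u.
  by rewrite expr0 scale1r => ->; exists u.
rewrite exprSr -scalerA => /IHf[v].
elim: e w v {u IHf} => [|e IHe] w v.
  by move=> _; exists w; rewrite expr0 scale1r.
rewrite exprS -scalerA => yw; have [w' ww'] := yreg _ _ yw.
have /IHe[v' w'v'] : y *: w' = x ^+ e *: v.
  apply/eqP; rewrite -subr_eq0; apply/eqP/xreg.
  by rewrite scalerBr -yw ww' !scalerA [x * y]mulrC subrr.
by exists v'; rewrite ww' w'v' scalerA.
Qed.

(** An elementary form of Hom(I, W) = W for an ideal I containing a regular pair: y u = x v makes
    [u] a multiple x g, and for any other pair x w = r u = x r g, where [x] cancels. *)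
Lemma regular_pair_common_factor x y (T : R -> W -> Prop) u v :
  regular_pair x y ->
  (forall r w r' w', T r w -> T r' w' -> r *: w' = r' *: w) ->
  T x u -> T y v -> exists g, forall r w, T r w -> w = r *: g.
Proof.
case=> xreg yreg sym Txu Tyv; have [g ug] := yreg _ _ (sym _ _ _ _ Tyv Txu).
exists g => r w /(sym _ _ _ _ Txu) xw; apply/eqP; rewrite -subr_eq0.
by apply/eqP/xreg; rewrite scalerBr xw ug !scalerA [r * x]mulrC subrr.
Qed.

Lemma regular_seq_pair x y s :
  regular_seq W [:: x, y & s] -> regular_pair x y.
Proof.
case=> reg _; split=> [w xw|w u yw].
  have /(_ w) := reg 0%N isT; rewrite /= => h.
  have [|t ht ->] := h; first by exists [::]; rewrite ?big_nil.
  by rewrite big_seq big1 // => p /ht[].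
have sub (z : W) : smul [set` [:: x]] setT z -> exists v, z = x *: v.
  apply: (@smulS _ _ _ _ [set z | exists v, z = x *: v]).
    apply: submoduleI => [|c _ _ [v ->] [v' ->]]; first by exists 0; rewrite scaler0.
    by exists (c *: v + v'); rewrite scalerDr !scalerA [c * x]mulrC.
  by move=> r v /=; rewrite inE => /eqP -> _; exists v.
apply: sub; have /(_ w) := reg 1%N isT; rewrite /= ?take0; apply.
by rewrite yw; apply: smulM => //=; rewrite inE.
Qed.

End RegularPair.

Lemma ipowX (R : comPzRingType) (I : set R) n v : I v -> ipow I n (v ^+ n).
Proof.
move=> Iv; elim: n => [//|n IH].
by rewrite exprS; apply: (@smulM R R^o).
Qed.

(* [Defs.span] weighs a repeated generator by its multiplicity, so the
   generators of an ideal [Defs.span s] are the multiples [v *+ count_mem v s]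
   and not the elements of [s]. *)
Lemma noetherian_generators (R : comPzRingType) (I : set R) :
  noetherian R -> ideal I ->
  exists2 t : seq R, {in t, forall v, I v} & I `<=` @smul R R^o [set` t] setT.
Proof.
move=> noeth /noeth[s ->]; exists [seq v *+ count_mem v s | v <- s].
  move=> _ /mapP[v vs ->]; exists (fun w => (w == v)%:R).
  rewrite -iter_addr_0 -big_const_seq big_mkcond /=; apply: eq_bigr => w _.
  by case: eqP => [->|_]; rewrite ?scale1r ?scale0r.
move=> _ [c ->]; rewrite -big_undup_iterop_count.
exists [seq (v *+ count_mem v s, c v) | v <- undup s].
  by move=> p /mapP[v]; rewrite mem_undup => vs ->; split=> //=; apply: map_f.
rewrite big_map; apply: eq_bigr => v _ /=.
by rewrite Monoid.iteropE iter_addr_0 scalerMnr [RHS]mulrC.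
Qed.

(** Splitting a generator v off a product replaces [J] by the colon ideal J : v and lowers [n] by
    one. *)
Lemma ipow_sub_monomials (R : comPzRingType) (I J : set R) (t : seq R) n :
  I `<=` @smul R R^o [set` t] setT -> ideal J ->
  (forall w : seq R, {subset w <= t} -> size w = n -> J (\prod_(x <- w) x)) ->
  ipow I n `<=` J.
Proof.
move=> It; elim: n J => [|n IH] J Ji mon.
  move=> z _; rewrite -[z]mulr1; apply: (submodZ Ji).
  by have := mon [::]; rewrite big_nil; apply.
apply: (@smulS R R^o) => // r z /It[s hs ->] Iz; rewrite scaler_suml.
apply: (submod_sum_seq Ji) => -[v c] /hs[/= vt _].
have -> : (v *: (c : R^o)) *: (z : R^o) = c *: (v * z : R^o).
  by rewrite /GRing.scale /= mulrA [v * c]mulrC.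
apply: (submodZ Ji); apply: (IH [set y | J (v * y)]) Iz.
  apply: submoduleI => [|d x y Jx Jy] /=.
    by rewrite mulr0; apply: (submod0 Ji).
  have -> : v * (d *: (x : R^o) + y) = d *: (v * x : R^o) + v * y.
    by rewrite mulrDr [in LHS]/GRing.scale /= mulrCA.
  exact: (submodZD Ji).
move=> w wt wn /=; have := mon (v :: w); rewrite big_cons.
apply; last by rewrite /= wn.
by move=> x; rewrite inE => /predU1P[->|/wt].
Qed.

Lemma ipow_sub_of_radical (R : comPzRingType) (I J : set R) (t : seq R) :
  I `<=` @smul R R^o [set` t] setT -> ideal J ->
  {in t, forall v, radical J v} -> exists n, ipow I n `<=` J.
Proof.
move=> It Ji rad.
have /choice[e he] : forall v : R, exists k, v \in t -> J (v ^+ k).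
  move=> v; case: (boolP (v \in t)) => [/rad[k]|_]; last by exists 0%N.
  by exists k.
(* Pigeonhole: a monomial with one factor more than the sum of the [e v] contains some [v] at least
   [e v] times. *)
exists (\sum_(v <- undup t) e v).+1; apply: (ipow_sub_monomials It Ji) => w wt wn.
have [/hasP[v vt lev]|/hasPn h] :=
  boolP (has (fun v => e v <= count_mem v w)%N (undup t)).
  have {}vt : v \in t by rewrite -mem_undup.
  have -> : \prod_(x <- w) x =
      (v ^+ (count_mem v w - e v) * \prod_(x <- w | x != v) x) * v ^+ e v.
    rewrite mulrAC -exprD subnK // (bigID (pred1 v)) /=; congr (_ * _).
    rewrite (eq_bigr (fun=> v)) => [|x /eqP//].
    by rewrite big_const_seq iter_mulr_1.
  exact/(submodZ Ji)/he.
have : (size w <= \sum_(v <- undup t) count_mem v w)%N.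
  rewrite -sum1_size; under [leqRHS]eq_bigr do rewrite -sum1_count big_mkcond /=.
  rewrite exchange_big big_seq [leqRHS]big_seq; apply: leq_sum => x /wt xt.
  by rewrite (bigD1_seq x) ?mem_undup ?undup_uniq //= eqxx.
rewrite wn ltnNge big_seq [leqRHS]big_seq leq_sum // => v /h.
by rewrite -ltnNge => /ltnW.
Qed.

(** * Monomials in Rees algebras and Rees modules *)

Section ReesMonomials.
Variables (A : comNzRingType) (a : set A).
Implicit Types (c : A) (i j k : nat) (p : rees a).

Lemma ipow0 i : ipow a i 0. Proof. exact: (submod0 (ipow_ideal a i)). Qed.

Lemma ipow1 c : a c -> ipow a 1 c.
Proof. by move=> ac; rewrite -[c]mulr1; apply: (@smulM A A^o). Qed.

Fact rees_mono_subproof i c : ipow a i c -> c *: 'X^i \in @rees_pred A a.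
Proof.
move=> ac; apply/rees_predP => j; rewrite coefZ coefXn.
by case: eqP => [->|_]; rewrite ?mulr1 // mulr0; apply: ipow0.
Qed.

(* The element c t^i of the Rees algebra, with junk value 0 when c is not in
   a^i. *)
Definition rees_mono i c : rees a := insubd 0 (c *: 'X^i).

Lemma rees_monoE i c : ipow a i c -> rees_val (rees_mono i c) = c *: 'X^i.
Proof. by move=> ac; rewrite [LHS]val_insubd rees_mono_subproof. Qed.

Lemma rees_mono_coef i c j :
  ipow a i c -> (rees_val (rees_mono i c))`_j = if j == i then c else 0.
Proof.
by move=> ac; rewrite rees_monoE // coefZ coefXn; case: eqP; rewrite ?mulr1 ?mulr0.
Qed.

Lemma rees_mono_part i c : ipow a i c -> rees_part a i (rees_mono i c).
Proof.
by move=> ac j ji; rewrite rees_mono_coef //; case: eqP => // ij; case: ji; rewrite ij.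
Qed.

Lemma rees_monoM i j c d : ipow a i c -> ipow a j d ->
  rees_mono i c * rees_mono j d = rees_mono (i + j) (c * d).
Proof.
move=> ac ad; apply: val_inj; rewrite /= [RHS]rees_monoE; last exact: ipowM.
by rewrite !rees_monoE // -scalerAl -scalerAr scalerA exprD.
Qed.

Lemma rees_monoX i c e :
  ipow a i c -> rees_mono i c ^+ e = rees_mono (i * e) (c ^+ e).
Proof.
move=> ac; have aX n : ipow a (i * n) (c ^+ n).
  by elim: n => [|n IH]; rewrite ?muln0 // exprS mulnS; apply: ipowM.
elim: e => [|e IH]; last by rewrite !exprS IH mulnS rees_monoM.
by apply: val_inj; rewrite /= rees_monoE // muln0 expr0 scale1r.
Qed.

Lemma rees_monoD i c d : ipow a i c -> ipow a i d ->
  rees_mono i (c + d) = rees_mono i c + rees_mono i d.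
Proof.
move=> ac ad; apply: val_inj; rewrite /= !rees_monoE ?scalerDl //.
exact: (submodD (ipow_ideal a i)).
Qed.

Lemma rees_mono0 i : rees_mono i 0 = 0.
Proof. by apply: val_inj; rewrite /= rees_monoE ?scale0r //; apply: ipow0. Qed.

Lemma rees_val_sum (I : Type) (r : seq I) (P : pred I) (F : I -> rees a) :
  rees_val (\sum_(i <- r | P i) F i) = \sum_(i <- r | P i) rees_val (F i).
Proof. exact: (raddf_sum (val : rees a -> {poly A})). Qed.

Lemma rees_sum_mono p :
  p = \sum_(i <- iota 0 (size (rees_val p))) rees_mono i (rees_val p)`_i.
Proof.
apply: val_inj; rewrite /= rees_val_sum -{1}[size _]subn0 big_mkord.
rewrite -[LHS]coefK poly_def; apply: eq_bigr => i _.
by rewrite rees_monoE //; apply: rees_coef.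
Qed.

Lemma rees_sum_mono_ge p k : (forall i, (i < k)%N -> (rees_val p)`_i = 0) ->
  p = \sum_(i <- iota 0 (size (rees_val p)) | (k <= i)%N)
        rees_mono i (rees_val p)`_i.
Proof.
move=> p0; rewrite [LHS]rees_sum_mono [LHS](bigID (leq k)) /=.
rewrite [X in _ + X]big1 ?addr0 // => i.
by rewrite -ltnNge => /p0 ->; rewrite rees_mono0.
Qed.

Lemma coef_expr_low (p : {poly A}) k i :
  p`_0 = 0 -> (i < k)%N -> (p ^+ k)`_i = 0.
Proof.
move=> p0; elim: k i => [//|k IH] i; rewrite ltnS exprS coefM => ik.
apply: big1 => j _; case: (posnP j) => [->|j0]; first by rewrite p0 mul0r.
by rewrite IH ?mulr0 //; have := ltn_ord j; lia.
Qed.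

End ReesMonomials.

Section ReesModuleMonomials.
Variables (A : comNzRingType) (a : set A) (M : lmodType A).
Implicit Types F P Q : afamily a M.

Lemma pact_mono c i (f : int -> M) n : pact (c *: 'X^i) f n = c *: f (n - i%:Z).
Proof.
rewrite pactZl [LHS]/GRing.scale /=; congr (_ *: _).
elim: i n => [|i IH] n; first by rewrite expr0 -polyC1 pactC scale1r subr0.
by rewrite exprSr pact_mulX IH; congr f; lia.
Qed.

Lemma rees_mono_scale F i c (f : reesmod F) n : ipow a i c ->
  reesmod_val (rees_mono a i c *: f) n = c *: reesmod_val f (n - i%:Z).
Proof. by move=> ac; rewrite [LHS]/= rees_monoE // pact_mono. Qed.

Lemma reesmod_valB F (f g : reesmod F) n :
  reesmod_val (f - g) n = reesmod_val f n - reesmod_val g n.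
Proof. by []. Qed.

Fact reesmod_mono_subproof F n x : F n x ->
  (fun k : int => if k == n then x else 0) \in reesmod_pred F.
Proof.
move=> Fx; apply/reesmod_predP; split=> [|k]; last first.
  by case: eqP => [->//|_]; exact: (submod0 (afam_sub F k)).
by exists [:: n] => k; rewrite inE => /negPf ->.
Qed.

(* The element x t^n of the Rees module, with junk value 0 when x is not in
   F n. *)
Definition reesmod_mono F n x : reesmod F :=
  insubd 0 (fun k : int => if k == n then x else 0).

Lemma reesmod_monoE F n x k : F n x ->
  reesmod_val (reesmod_mono F n x) k = if k == n then x else 0.
Proof.
by move=> Fx; rewrite [reesmod_val _]val_insubd reesmod_mono_subproof.
Qed.

Definition gr_mono F n x : gr_mod F := subquot_pi _ (reesmod_mono F n x).

Lemma gr_mono_eq F n x y : F n x -> F n y ->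
  F (n + 1) (x - y) -> gr_mono F n x = gr_mono F n y.
Proof.
move=> Fx Fy h; apply/quotmod_piP => k; rewrite reesmod_valB !reesmod_monoE //.
by case: eqP => [->//|_]; rewrite subr0; apply: (submod0 (afam_sub F _)).
Qed.

Lemma gr_mono_eq0 F n x : F n x -> gr_mono F n x = 0 <-> F (n + 1) x.
Proof.
move=> Fx; split=> [/subquot_pi0/(_ n)|h]; first by rewrite reesmod_monoE // eqxx.
apply/subquot_pi0 => k; rewrite reesmod_monoE //.
by case: eqP => [->//|_]; apply: (submod0 (afam_sub F _)).
Qed.

Lemma gr_mono_scale F n x i c : F n x -> ipow a i c ->
  gr_pi (rees_mono a i c) *: gr_mono F n x = gr_mono F (n + i%:Z) (c *: x).
Proof.
move=> Fx ac; rewrite [LHS]gr_scaleE /gr_mono -linearZ; congr subquot_pi.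
apply/val_inj/funext => k; rewrite [LHS]rees_mono_scale // reesmod_monoE //.
rewrite [RHS]reesmod_monoE; last exact: afam_ipow.
by rewrite subr_eq; case: eqP; rewrite ?scaler0.
Qed.

(** Components of degree n + i are compared; [y] is the degree n coefficient of a representative of
    [u], which need not be homogeneous. *)
Lemma gr_mono_scale_coef F n x i c (u : gr_mod F) : F (n + i%:Z) x -> ipow a i c ->
  gr_mono F (n + i%:Z) x = gr_pi (rees_mono a i c) *: u ->
  exists2 y, F n y & F (n + i%:Z + 1) (x - c *: y).
Proof.
move=> Fx ac; rewrite [X in _ = X]gr_scaleE -(subquot_piK u) -linearZ.
move=> /quotmod_piP/(_ (n + i%:Z)) h; exists (reesmod_val (subquot_repr u) n).
  exact: reesmod_coef.
move: h; rewrite reesmod_valB reesmod_monoE // eqxx rees_mono_scale //.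
by rewrite addrK.
Qed.

End ReesModuleMonomials.

(** * Compatible families over a filtration with regular associated graded module *)

Section CompatibleFamilies.
Variables (A : comNzRingType) (b : set A) (M : lmodType A) (H : afamily b M).

(* Values modulo H_(p+i) of maps b^i -> M / H_(p+i), i >= k. Additivity is not
   required: the symmetry condition is all that the regular sequence sees. *)
Definition compatible (k : nat) (p : int) (phi : nat -> A -> M) : Prop :=
  forall i j c d, (k <= i)%N -> (k <= j)%N -> ipow b i c -> ipow b j d ->
    H (p + i%:Z + j%:Z) (d *: phi i c - c *: phi j d).

(* x is nilpotent modulo the irrelevant ideal of the associated graded ring. *)
Definition high_power (x : gr_ring b) : Prop :=
  forall k, exists e, exists2 P : rees b,
    forall i, (i < k)%N -> (rees_val P)`_i = 0 & x ^+ e = gr_pi P.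

Lemma gr_pi_sum_ge (P : rees b) k :
  (forall i, (i < k)%N -> (rees_val P)`_i = 0) ->
  gr_pi P = \sum_(i <- iota 0 (size (rees_val P)) | (k <= i)%N)
              gr_pi (rees_mono b i (rees_val P)`_i).
Proof.
by move=> P0; rewrite {1}(rees_sum_mono_ge P0); apply: (raddf_sum (quotmod_pi _)).
Qed.

Variables x y : gr_ring b.
Hypothesis reg : regular_pair (gr_mod H) x y.
Hypothesis highx : high_power x.

(** A power of [x] is a sum of classes of monomials of degree at least [k]. Each of them kills the
    class of [g], on which that power is injective. *)
Lemma gr_torsion_free q k g : H q g ->
  (forall i c, (k <= i)%N -> ipow b i c -> H (q + i%:Z + 1) (c *: g)) ->
  H (q + 1) g.
Proof.
move=> Hg tors; have [e [P P0 xP]] := highx k.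
have [xreg _] := regular_pairX e 0 reg.
apply/(gr_mono_eq0 Hg)/xreg; rewrite xP (gr_pi_sum_ge P0) scaler_suml.
apply: big1 => i ki; have bi := rees_coef P i.
rewrite gr_mono_scale //; apply/gr_mono_eq0; last exact: tors.
exact: afam_ipow.
Qed.

Hypothesis highy : high_power y.

(** Suitable powers of [x] and [y] are sums of classes of monomials of degree at least [k], where
    [psi] has values. They still form a regular pair, so the common factor lemma applies. *)
Lemma compatible_mul_by k q psi :
  (forall i c, (k <= i)%N -> ipow b i c -> H (q + i%:Z) (psi i c)) ->
  compatible k (q + 1) psi ->
  exists u : gr_mod H, forall i c, (k <= i)%N -> ipow b i c ->
    gr_mono H (q + i%:Z) (psi i c) = gr_pi (rees_mono b i c) *: u.
Proof.
move=> Hpsi comp.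
(* [psi] extended to sums of monomials; a relation, because different sums may represent the same
   [r]. *)
pose T (r : gr_ring b) (w : gr_mod H) := exists (s : seq nat) (c : nat -> A),
  [/\ {in s, forall i, (k <= i)%N /\ ipow b i (c i)},
      r = \sum_(i <- s) gr_pi (rees_mono b i (c i)) &
      w = \sum_(i <- s) gr_mono H (q + i%:Z) (psi i (c i))].
have highT z : high_power z -> exists e w, T (z ^+ e) w.
  move=> /(_ k)[e [P P0 zP]]; exists e; rewrite zP (gr_pi_sum_ge P0) -big_filter.
  eexists; exists [seq i <- iota 0 (size (rees_val P)) | (k <= i)%N].
  exists (fun i => (rees_val P)`_i); split; [|by []|by []].
  by move=> i; rewrite mem_filter => /andP[ki _]; split=> //; apply: rees_coef.
have [e [v Tv]] := highT _ highx; have [f [w Tw]] := highT _ highy.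
have [|u hu] := regular_pair_common_factor (regular_pairX e f reg) _ Tv Tw.
  move=> _ _ _ _ [s [c [hc -> ->]]] [t [d [hd -> ->]]].
  rewrite !scaler_suml.
  under eq_bigr do rewrite scaler_sumr.
  under [RHS]eq_bigr do rewrite scaler_sumr.
  rewrite exchange_big; apply: eq_big_seq => j /hd[kj bd].
  apply: eq_big_seq => i /hc[ki bc].
  have Hi := Hpsi _ _ ki bc; have Hj := Hpsi _ _ kj bd.
  rewrite !gr_mono_scale // addrAC; apply: gr_mono_eq.
  - by rewrite addrAC; apply: afam_ipow.
  - exact: afam_ipow.
  - have := comp _ _ _ _ kj ki bd bc; congr (H _ _); lia.
exists u => i c ki bc; apply: hu; exists [:: i], (fun=> c); rewrite !big_seq1.
by split=> // j; rewrite inE => /eqP ->.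
Qed.

Hypothesis H_dec : forall n, H (n + 1) `<=` H n.
Hypothesis H_top : forall n : int, n <= 0 -> H n = setT.

Lemma afam_dec n n' : n <= n' -> H n' `<=` H n.
Proof.
move=> le; have -> : n' = n + `|n' - n|%N%:Z by lia.
elim: `|_|%N => [|i IH] z; first by rewrite addr0.
by rewrite (_ : n + _ = n + i%:Z + 1); [move=> /H_dec/IH|lia].
Qed.

(** The classes of [phi] in the associated graded module are multiples of one element [u]. Only its
    component in degree p - 1 matters, and this is zero since H_(p-1) = H_p = M. *)
Lemma compatible_step k p phi : p <= 0 -> compatible k p phi ->
  (forall i c, (k <= i)%N -> ipow b i c -> H (p + i%:Z - 1) (phi i c)) ->
  forall i c, (k <= i)%N -> ipow b i c -> H (p + i%:Z) (phi i c).
Proof.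
move=> p0 comp Hphi i c ki bc.
have [u hu] : exists u : gr_mod H, forall i c, (k <= i)%N -> ipow b i c ->
    gr_mono H (p - 1 + i%:Z) (phi i c) = gr_pi (rees_mono b i c) *: u.
  apply: compatible_mul_by; last by rewrite subrK.
  by move=> j d kj bd; rewrite addrAC; apply: Hphi.
have [|z _] := gr_mono_scale_coef _ bc (hu _ _ ki bc).
  by rewrite addrAC; apply: Hphi.
rewrite (_ : p - 1 + i%:Z + 1 = p + i%:Z); last by lia.
move=> h; rewrite -[phi i c](subrK (c *: z)).
apply: (submodD (afam_sub H _)) => //; apply: afam_ipow => //.
by rewrite H_top.
Qed.

(** Starting from H_0 = M, [gr_torsion_free] moves [g] up the filtration one step at a time until
    degree [r]. *)
Lemma gr_torsion_free_iter k (r : int) g :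
  (forall i c, (k <= i)%N -> ipow b i c -> H (r + i%:Z) (c *: g)) -> H r g.
Proof.
move=> tors; have [r0|r0] := lerP r 0; first by rewrite H_top.
suff h (q : nat) : q%:Z <= r -> H q%:Z g.
  by have := h `|r|%N; rewrite (_ : `|r|%N%:Z = r); [apply|lia].
elim: q => [|q IH] qr; first by rewrite H_top.
have -> : q.+1%:Z = q%:Z + 1 by lia.
apply: (gr_torsion_free (k := k)) => [|i c ki bc]; first by apply: IH; lia.
by apply: afam_dec (tors _ _ ki bc); lia.
Qed.

(* If b phi = 0 then (b t) phi, of degree one more, vanishes by
   [compatible_step]; so the torsion element phi is 0. *)
Lemma compatible_annihilated k p phi : (0 < k)%N -> p < 0 ->
  compatible k p phi ->
  (forall e i c, b e -> (k <= i)%N -> ipow b i c -> H (p + i%:Z) (e *: phi i c)) ->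
  forall i c, (k <= i)%N -> ipow b i c -> H (p + i%:Z) (phi i c).
Proof.
move=> k0 p0 comp ann i c ki bc.
have bt e j d : b e -> (k <= j)%N -> ipow b j d -> H (p + 1 + j%:Z) (e *: phi j d).
  move=> be; move: j d; apply: compatible_step.
  - by lia.
  - move=> i1 i2 c1 c2 k1 k2 b1 b2.
    have -> : c2 *: (e *: phi i1 c1) - c1 *: (e *: phi i2 c2) =
        e *: (c2 *: phi i1 c1 - c1 *: phi i2 c2).
      by rewrite scalerBr !scalerA ![e * _]mulrC.
    have -> : p + 1 + i1%:Z + i2%:Z = p + i1%:Z + i2%:Z + 1 by lia.
    by apply/afam_mul/smulM => //; apply: comp.
  - move=> j d kj bd; have := ann _ _ _ be kj bd; congr (H _ _); lia.
apply: (gr_torsion_free_iter (k := k)) => j d kj bd.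
(* Symmetry trades d phi_i(c) for c phi_j(d). As i is positive, c is a sum of products of an element
   of [b] with one of b^(i-1); by [bt] the first factor gains the missing degree. *)
rewrite -[d *: _](subrK (c *: phi j d)); apply: (submodD (afam_sub H _)).
  exact: comp.
case: i ki bc => [|i] ki; first by lia.
case=> s hs ->; rewrite scaler_suml.
apply: (submod_sum_seq (afam_sub H _)) => -[e c0] /hs[/= be bc0].
rewrite -[e *: (c0 : A^o)]/(e * c0) mulrC -scalerA.
have := @afam_ipow A b M H i c0 _ _ bc0 (bt _ _ _ be kj bd); congr (H _ _); lia.
Qed.

(** The family is killed by b^k, and this exponent is then lowered to 0 one step at a time. *)
Lemma compatible_vanish_lt0 k p phi : (0 < k)%N -> p < 0 ->
  compatible k p phi ->
  forall i c, (k <= i)%N -> ipow b i c -> H (p + i%:Z) (phi i c).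
Proof.
move=> k0 p0; suff vanish N psi : compatible k p psi ->
    (forall e i c, ipow b N e -> (k <= i)%N -> ipow b i c ->
       H (p + i%:Z) (e *: psi i c)) ->
    forall i c, (k <= i)%N -> ipow b i c -> H (p + i%:Z) (psi i c).
  move=> comp; apply: (vanish k) => // e i c be ki bc.
  (* For e in b^k, e phi_i(c) is congruent to c phi_k(e), which lies in b^i M, hence in H_i and in
     the larger H_(p+i). *)
  rewrite -[e *: _](subrK (c *: phi k e)); apply: (submodD (afam_sub H _)).
    by apply: afam_dec (comp _ _ _ _ ki (leqnn k) bc be); lia.
  have := @afam_ipow _ _ _ H _ _ 0 (phi k e) bc; rewrite H_top // => /(_ I).
  by apply: afam_dec; lia.
elim: N psi => [|N IH] psi comp ann.
  by move=> i c ki bc; rewrite -[psi i c]scale1r; apply: ann.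
(* For e in b^N the family e psi is again compatible and is killed by [b]. *)
apply: IH => // e i c be; move: i c; apply: (compatible_annihilated k0 p0).
  move=> i1 i2 c1 c2 k1 k2 b1 b2.
  have -> : c2 *: (e *: psi i1 c1) - c1 *: (e *: psi i2 c2) =
      e *: (c2 *: psi i1 c1 - c1 *: psi i2 c2).
    by rewrite scalerBr !scalerA ![e * _]mulrC.
  by apply: (submodZ (afam_sub H _)); apply: comp.
move=> e' i c be' ki bc; rewrite scalerA; apply: ann => //.
exact: (@smulM A A^o).
Qed.

(** To include p = 0, the family is first read modulo H_(p-1+i), where the negative case applies;
    one [compatible_step] recovers the lost degree. *)
Lemma compatible_vanish k p phi : (0 < k)%N -> p <= 0 ->
  compatible k p phi ->
  forall i c, (k <= i)%N -> ipow b i c -> H (p + i%:Z) (phi i c).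
Proof.
move=> k0 p0 comp; apply: (compatible_step p0 comp) => i c ki bc.
rewrite addrAC; apply: (compatible_vanish_lt0 k0) ki bc; first by lia.
by move=> i1 i2 c1 c2 k1 k2 b1 b2; apply: afam_dec (comp _ _ _ _ k1 k2 b1 b2); lia.
Qed.

End CompatibleFamilies.

(** * Local cohomology of [Lmod F] in negative degrees *)

Lemma linear_bundle (R : pzRingType) (V W : lmodType R) (f : V -> W) :
  linear f -> exists g : {linear V -> W}, f = g.
Proof.
by move=> fl; exists (HB.pack_for {linear V -> W} f
  (GRing.isLinear.Build _ _ _ _ f fl)).
Qed.

Section GradedModules.
Variables (S : pzRingType) (Sg : int -> set S).
Implicit Types X Y : gmodule Sg.

Lemma gpartB X n (x x' : X) : gpart n x -> gpart n x' -> gpart n (x - x').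
Proof.
have [/(_ n)[_ sub] _ _] := gpart_grading X.
by move=> gx gx'; apply/set_mem/sub; apply/mem_set.
Qed.

Lemma gpart0 X n : gpart n (0 : X).
Proof. by have [/(_ n)[/set_mem]] := gpart_grading X. Qed.

Lemma gpartMn X n (x : X) k : gpart n x -> gpart n (x *+ k).
Proof.
move=> gx; elim: k => [|k IH]; first by rewrite mulr0n; apply: gpart0.
rewrite mulrS -[_ *+ k]opprK; apply: gpartB => //.
by rewrite -sub0r; apply: gpartB => //; apply: gpart0.
Qed.

(** The degree n component of [x] has the same image, by uniqueness of homogeneous decompositions in
    [Y]. *)
Lemma ghom_part X Y (f : X -> Y) n x :
  ghom f -> gpart n (f x) -> exists2 x', gpart n x' & f x' = f x.
Proof.
case=> /linear_bundle[{}f ->] fg gfx.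
have [_ /(_ x)[s [c gc xE]] _] := gpart_grading X.
(* Degrees may repeat in [s]: equal ones are merged, and [c'] is 0 in degrees outside [s]. *)
pose c' j := c j *+ count_mem j s.
have gc' j : gpart j (c' j) by exact: gpartMn.
have {}xE : x = \sum_(j <- undup s) c' j.
  rewrite xE -big_undup_iterop_count; apply: eq_bigr => j _.
  by rewrite Monoid.iteropE iter_addr_0.
(* Degree [n] is listed even if it does not occur in [s], so that the decompositions of [f x] can be
   compared there. *)
exists (c' n) => //; pose t := n :: [seq j <- undup s | j != n].
have xt : x = \sum_(j <- t) c' j.
  rewrite big_cons big_filter xE; have [ns|ns] := boolP (n \in undup s).
    by rewrite (bigD1_seq n) ?undup_uniq.
  have -> : c' n = 0 by rewrite /c' (count_memPn _) // -mem_undup.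
  rewrite add0r big_seq [RHS]big_seq_cond.
  apply: eq_bigl => j; case: (boolP (j \in _)) => //= js.
  by apply/esym; apply: contraNneq ns => <-.
have [_ _ /(_ t (fun j => f (c' j) - (if j == n then f x else 0)))] :=
  gpart_grading Y.
move=> comp0; suff /comp0 : uniq t.
  move/(_ _ _ n (mem_head _ _)); rewrite eqxx => h; apply/eqP; rewrite -subr_eq0.
  apply/eqP/h => [j|].
    apply: gpartB; first exact: fg.
    by case: eqP => [->|_] //; apply: gpart0.
  rewrite sumrB -raddf_sum -xt /t big_cons eqxx big_filter big1 ?addr0 ?subrr //.
  by move=> j /negPf ->.
by rewrite /= mem_filter eqxx filter_uniq ?undup_uniq.
Qed.

End GradedModules.

(** * Generators and powers of the maximal homogeneous ideal *)

Section ReesMaximalIdeal.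
Variables (A : comNzRingType) (a m : set A).

(** Reduces membership of c t^i in [N] to generators of ideals of [A]. The condition on [ipow]
    excludes the junk values of [rees_mono]. *)
Lemma rees_mono_ideal (N : set (rees a)) i : ideal N ->
  ideal [set c | ipow a i c /\ N (rees_mono a i c)].
Proof.
move=> Ni; apply: submoduleI => [|d x y [ax Nx] [ay Ny]].
  by split; [apply: ipow0|rewrite rees_mono0; apply: (submod0 Ni)].
have adx : ipow a i (d * x) by apply: (submodZ (ipow_ideal a i)).
split; first exact: (submodD (ipow_ideal a i)).
rewrite rees_monoD //; apply: (submodD Ni) => //.
rewrite -[rees_mono a i _](@rees_monoM _ _ 0 i d x) //; exact: (submodZ Ni).
Qed.

Lemma rees_ideal_mono (N : set (rees a)) i c : ideal N ->
  (forall g, a g -> N (rees_mono a 1 g)) -> (0 < i)%N -> ipow a i c ->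
  N (rees_mono a i c).
Proof.
move=> Ni N1; case: i => [//|i] _.
suff sub : @smul A A^o a (ipow a i) `<=` [set c | ipow a i.+1 c /\ N (rees_mono a i.+1 c)].
  by move=> /sub[].
apply: (@smulS A A^o); first exact: rees_mono_ideal.
move=> g d ag ad; have a1g := ipow1 ag; split; first exact: (@smulM A A^o).
rewrite -[rees_mono a i.+1 _](@rees_monoM _ _ 1 i g d) // mulrC.
by apply/(submodZ Ni)/N1.
Qed.

Hypothesis m_ideal : ideal m.
Hypothesis a_ideal : ideal a.

Lemma rees_max_mono0 v : m v -> rees_max a m (rees_mono a 0 v).
Proof. by move=> mv; rewrite /rees_max /= rees_mono_coef. Qed.

Lemma rees_max_mono i c : (0 < i)%N -> ipow a i c ->
  rees_max a m (rees_mono a i c).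
Proof.
move=> i0 ac; rewrite /rees_max /= rees_mono_coef // eq_sym gtn_eqF //.
exact: (submod0 m_ideal).
Qed.

Lemma ipow_rees_max_mono k i c : (k <= i)%N -> ipow a i c ->
  ipow (rees_max a m) k (rees_mono a i c).
Proof.
elim: k i c => [//|k IH] [//|i] c ki.
have Ni := ipow_ideal (rees_max a m) k.+1.
suff sub : @smul A A^o a (ipow a i) `<=`
    [set c | ipow a i.+1 c /\ ipow (rees_max a m) k.+1 (rees_mono a i.+1 c)].
  by move=> /sub[].
apply: (@smulS A A^o); first exact: rees_mono_ideal.
move=> g d ag ad; have a1g := ipow1 ag; split; first exact: (@smulM A A^o).
rewrite -[rees_mono a i.+1 _](@rees_monoM _ _ 1 i g d) //.
by apply: (@smulM (rees a) (rees a)^o); [exact: rees_max_mono|exact: IH].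
Qed.

(** Generators of [m] are placed in degree 0 and generators of [a] in degree 1; the latter produce
    all monomials of positive degree. *)
Lemma rees_max_generators : noetherian A ->
  exists2 t : seq (rees a),
    {in t, forall s, (exists2 v, m v & s = rees_mono a 0 v) \/
                     (exists2 g, a g & s = rees_mono a 1 g)} &
    rees_max a m `<=` @smul (rees a) (rees a)^o [set` t] setT.
Proof.
move=> noeth; have [tm tmP tm_gen] := noetherian_generators noeth m_ideal.
have [ta taP ta_gen] := noetherian_generators noeth a_ideal.
exists ([seq rees_mono a 0 v | v <- tm] ++ [seq rees_mono a 1 g | g <- ta]).
  move=> s; rewrite mem_cat => /orP[/mapP[v /tmP mv ->]|/mapP[g /taP ag ->]].
    by left; exists v.
  by right; exists g.
set t := _ ++ _; set N := smul _ _ => p mp.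
have Ni : ideal N by apply: (@smul_submodule _ (rees a)^o); apply: submoduleI.
have tN s : s \in t -> N s.
  by move=> st; rewrite -[s]mulr1; apply: (@smulM (rees a) (rees a)^o).
have sub0 v : m v -> N (rees_mono a 0 v).
  suff sub : @smul A A^o [set` tm] setT `<=`
      [set c | ipow a 0 c /\ N (rees_mono a 0 c)] by move=> /tm_gen/sub[].
  apply: (@smulS A A^o) => [|w c wt _]; first exact: rees_mono_ideal.
  split=> //; rewrite -[rees_mono a 0 _](@rees_monoM _ _ 0 0 w c) // mulrC.
  by apply: (submodZ Ni); apply: tN; rewrite mem_cat map_f.
have sub1 g : a g -> N (rees_mono a 1 g).
  suff sub : @smul A A^o [set` ta] setT `<=`
      [set c | ipow a 1 c /\ N (rees_mono a 1 c)] by move=> /ta_gen/sub[].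
  apply: (@smulS A A^o) => [|w c wt _]; first exact: rees_mono_ideal.
  have aw : ipow a 1 w by apply/ipow1/taP.
  split; first by rewrite /GRing.scale /= mulrC; apply: (submodZ (ipow_ideal a 1)).
  rewrite -[rees_mono a 1 _](@rees_monoM _ _ 1 0 w c) // mulrC.
  by apply: (submodZ Ni); apply: tN; rewrite mem_cat map_f ?orbT.
rewrite (rees_sum_mono p); apply: (submod_sum Ni) => -[|i] _; first exact: sub0.
by apply: rees_ideal_mono => //; apply: rees_coef.
Qed.

End ReesMaximalIdeal.

Lemma rees_valX (A : comNzRingType) (b : set A) (p : rees b) e :
  rees_val (p ^+ e) = rees_val p ^+ e.
Proof.
by elim: e => [//|e IH]; rewrite !exprS [LHS]/(rees_val p * rees_val (p ^+ e)) IH.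
Qed.

Lemma gr_piX (A : comNzRingType) (b : set A) (p : rees b) e :
  gr_pi p ^+ e = gr_pi (p ^+ e).
Proof. by elim: e => [//|e IH]; rewrite !exprS IH; apply: gr_piM. Qed.

(** If the constant term p_0 of a representative satisfies p_0^e in [b], its e-th power vanishes in
    the graded ring. So x^e is represented by p^e - p_0^e, without constant term, whose k-th power
    starts in degree k. *)
Lemma gr_max_high_power (A : comNzRingType) (b m : set A) x :
  (forall v, m v -> exists e, b (v ^+ e)) -> gr_max b m x -> high_power x.
Proof.
move=> mb [p mp <-] k; have [e be] := mb _ mp.
pose p0 := rees_mono b 0 ((rees_val p)`_0 ^+ e).
have p0E : rees_val p0 = ((rees_val p)`_0 ^+ e)%:P.
  by rewrite rees_monoE // expr0 alg_polyC.
exists (e * k)%N, ((p ^+ e - p0) ^+ k) => [i|].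
  rewrite rees_valX; apply: coef_expr_low.
  rewrite [rees_val _]/(rees_val (p ^+ e) - rees_val p0) coefB p0E coefC /=.
  by rewrite rees_valX -!horner_coef0 horner_exp subrr.
rewrite exprM gr_piX -[RHS]gr_piX; congr (_ ^+ k).
apply/gr_piP => i; rewrite opprB addrCA subrr addr0 p0E coefC.
by case: eqP => [->|_]; [apply: ipow1|apply: ipow0].
Qed.

Lemma ipow_ipow (A : comNzRingType) (a : set A) l i c :
  ipow (ipow a l) i c -> ipow a (l * i) c.
Proof.
elim: i c => [|i IH] c; first by rewrite muln0.
rewrite mulnS; apply: (@smulS A A^o); first exact: (ipow_ideal a).
by move=> g d ag /IH; apply: ipowM.
Qed.

Section LModule.
Variables (A : comNzRingType) (a : set A) (M : lmodType A) (F : afamily a M).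
Implicit Type f : reesmod (afam_nonneg (afam_top a M)).

Definition Lmod_pi f : Lmod F := subquot_pi (afam_nonneg (afam_shift F 1)) f.

Lemma Lmod_pi_linear : linear Lmod_pi.
Proof. exact: subquot_pi_linear. Qed.

HB.instance Definition _ :=
  GRing.isLinear.Build (rees a) _ (Lmod F) _ Lmod_pi Lmod_pi_linear.

Lemma Lmod_pi_eq0 f : Lmod_pi f = 0 -> forall n, F (n + 1) (reesmod_val f n).
Proof.
move=> /subquot_pi0 h n; have := h n; rewrite /=.
by case: ifP => // _ ->; apply: (submod0 (afam_sub F _)).
Qed.

Lemma Lmod_pi_part_eq0 f n : (forall k, k <> n -> reesmod_val f k = 0) ->
  (0 <= n -> F (n + 1) (reesmod_val f n)) -> Lmod_pi f = 0.
Proof.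
move=> fn Ffn; apply/subquot_pi0 => k.
have [->|/eqP/fn ->] := eqVneq k n; last exact: (submod0 (afam_sub _ _)).
have := reesmod_coef f n; rewrite /=; case: ifP => [n0 _|//]; exact: Ffn.
Qed.

End LModule.

(** * Elements of negative degree that are torsion modulo [Lmod F] *)

Section TorsionModuloL.
Variables (A : comNzRingType) (a m : set A) (M : lmodType A) (F : afamily a M).
Hypothesis m_ideal : ideal m.

Variables (E : gmodule (rees_part a)) (eps : Lmod F -> E).
Hypotheses (eps_hom : ghom eps) (eps_inj : injective eps).

Variables (n : int) (k : nat) (y : E).
Hypotheses (n_lt0 : n < 0) (y_part : gpart n y).
Hypothesis y_L : forall s, ipow (rees_max a m) k s -> exists z, eps z = s *: y.

Lemma homogeneous_lift s i : rees_part a i s -> ipow (rees_max a m) k s ->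
  exists2 f : reesmod (afam_nonneg (afam_top a M)),
    forall j, j <> i + n -> reesmod_val f j = 0 & eps (Lmod_pi F f) = s *: y.
Proof.
move=> si /y_L[z ez]; have := gpart_scale si y_part; rewrite -ez => /ghom_part.
by case=> // _ [f hf <-] ef; exists f.
Qed.

(** The product lies in the image of the component of [Lmod F] of degree n < 0, which is zero. *)
Lemma degree0_kills s : rees_part a 0 s -> ipow (rees_max a m) k s -> s *: y = 0.
Proof.
move=> s0 /(homogeneous_lift s0)[f fn <-].
have [lin _] := eps_hom; have [g {}lin] := linear_bundle lin.
rewrite (@Lmod_pi_part_eq0 _ _ _ _ _ (0 + n)) //; last by lia.
by rewrite lin raddf0.
Qed.

Hypothesis F_dec : forall n, F (n + 1) `<=` F n.
Hypothesis F_top : forall n : int, n <= 0 -> F n = setT.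
Variables (l : nat) (x1 x2 : gr_ring (ipow a l)).
Hypothesis l_gt0 : (0 < l)%N.
Hypothesis reg : regular_pair (gr_mod (veronese F l)) x1 x2.
Hypotheses (high1 : high_power x1) (high2 : high_power x2).

Lemma degree1_power_kills g : a g ->
  exists e, rees_mono a 1 g ^+ e *: y = 0.
Proof.
move=> ag; have [lin _] := eps_hom; have [h {}lin] := linear_bundle lin.
have epsZ s u : eps (s *: u) = s *: eps u by rewrite lin linearZ.
have piZ s u : Lmod_pi F (s *: u) = s *: Lmod_pi F u by exact: linearZ.
have piB u v : Lmod_pi F (u - v) = Lmod_pi F u - Lmod_pi F v by exact: raddfB.
have /choice[f hf] : forall ic : nat * A,
    exists f : reesmod (afam_nonneg (afam_top a M)),
    (k <= ic.1)%N -> ipow a ic.1 ic.2 ->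
    (forall j, j <> ic.1%:Z + n -> reesmod_val f j = 0) /\
    eps (Lmod_pi F f) = rees_mono a ic.1 ic.2 *: y.
  move=> [i c]; have [[ki ac]|no] := pselect ((k <= i)%N /\ ipow a i c); last first.
    by exists 0 => ki ac; case: no.
  have [|f fi fy] := homogeneous_lift (rees_mono_part ac).
    exact: ipow_rees_max_mono.
  by exists f.
(* [theta i c] represents c t^i y in M / F_(n+i+1); [sym] is the commutativity of c t^i and d t^j
   acting on [y]. *)
pose theta i c := reesmod_val (f (i, c)) (n + i%:Z).
have sym i j c d : (k <= i)%N -> (k <= j)%N -> ipow a i c -> ipow a j d ->
    F (n + i%:Z + j%:Z + 1) (d *: theta i c - c *: theta j d).
  move=> ki kj ac ad; have [_ fi] := hf (i, c) ki ac; have [_ fj] := hf (j, d) kj ad.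
  have /Lmod_pi_eq0/(_ (n + i%:Z + j%:Z)) :
      Lmod_pi F (rees_mono a j d *: f (i, c) - rees_mono a i c *: f (j, d)) = 0.
    apply/eqP; rewrite piB subr_eq0; apply/eqP/eps_inj.
    by rewrite !piZ !epsZ fi fj !scalerA mulrC.
  rewrite reesmod_valB !rees_mono_scale // /theta.
  by rewrite addrK [n + i%:Z + _]addrAC addrK.
(* Multiplication by (g t)^e moves the index n + 1 to the next multiple p l of [l], still
   nonpositive, so that the family can be read over [veronese F l]. *)
pose N := `|- n - 1|%N; pose e := (N %% l)%N; pose p : int := - (N %/ l)%N%:Z.
have p_le0 : p <= 0 by rewrite oppr_le0.
have pE : p * l%:Z = n + 1 + e%:Z.
  have NE : - n - 1 = N%:Z by lia.
  have := divn_eq N l; rewrite -/e /p; move: (N %/ l)%N (e) NE => q e0; nia.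
have age : ipow a e (g ^+ e) by apply: ipowX.
(* The bound is [k.+1] because [compatible_vanish] needs a positive one. *)
have comp : compatible (veronese F l) k.+1 p (fun i c => g ^+ e *: theta (l * i)%N c).
  move=> i j c d ki kj /ipow_ipow ac /ipow_ipow ad.
  have ki' : (k <= l * i)%N by nia.
  have kj' : (k <= l * j)%N by nia.
  have := afam_ipow age (sym _ _ _ _ ki' kj' ac ad).
  rewrite scalerBr !scalerA ![g ^+ e * _]mulrC.
  congr (F _ _); rewrite !mulrDl pE; lia.
have dec j : veronese F l (j + 1) `<=` veronese F l j.
  by apply: (@afam_dec _ _ _ F F_dec); rewrite mulrDl mul1r lerDl.
have top (j : int) : j <= 0 -> veronese F l j = setT by move=> j0; apply: F_top; nia.
pose c := g ^+ l ^+ k.+1.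
have bc : ipow (ipow a l) k.+1 c by apply/ipowX/ipowX.
have ac := ipow_ipow bc.
have := compatible_vanish reg high1 high2 dec top (ltn0Sn k) p_le0 comp (leqnn _) bc.
move=> van; exists (e + l * k.+1)%N.
have kl : (k <= l * k.+1)%N by nia.
have [fn fy] := hf (_, c) kl ac; have a1g := ipow1 ag.
have -> : rees_mono a 1 g ^+ (e + l * k.+1) =
    rees_mono a e (g ^+ e) * rees_mono a (l * k.+1) c.
  by rewrite rees_monoX // mul1n rees_monoM // exprD exprM.
rewrite -scalerA -fy -epsZ -piZ.
rewrite (@Lmod_pi_part_eq0 _ _ _ _ _ (n + (l * k.+1)%N%:Z + e%:Z)) ?lin ?raddf0 //.
  by move=> j jn; rewrite rees_mono_scale // fn ?scaler0 //= => jE; apply: jn; lia.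
move=> _; rewrite rees_mono_scale // addrK.
by move: van; congr (F _ _); rewrite mulrDl pE; lia.
Qed.

End TorsionModuloL.

Theorem theorem1p9 (A : comNzRingType) (m : set A)
  (A_noeth : noetherian A) (A_local : local_ring m)
  (a : set A) (a_primary : primary_to m a)
  (M : lmodType A) (M_cm : cohen_macaulay m M)
  (r : nat) (M_dim : has_dim M r) (r_ge2 : (2 <= r)%N)
  (F : afamily a M) (F_stable : stable_filtration F)
  (F_top : forall n : int, n <= 0 -> F n = [set: M])
  (G_depth : exists k : nat, (1 <= k)%N /\
     depth_ge (gr_max (ipow a k) m) (gr_mod (veronese F k)) 2) :
  forall n : int, n < 0 -> loc_coh_eq0 (rees_max a m) (Lmod F) 1 n.
Proof.
move=> n n_lt0 E eps d [_ [eps_hom d_hom] eps_inj ex0 ex1] x [k tx] xn dx0.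
have [[m_ideal _ _] _] := A_local; have [[a_ideal _ _] am] := a_primary.
have [F_dec _ _] := F_stable; have [l [l_gt0 [xs [xsG xs_reg]]]] := G_depth.
case: xs xsG xs_reg => [|x1 [|x2 xs]] // xsG /regular_seq_pair reg _.
have mb v : m v -> exists e, ipow a l (v ^+ e).
  by rewrite -am => -[e ae]; exists (e * l)%N; rewrite exprM; apply: ipowX.
have high1 : high_power x1.
  by apply: (gr_max_high_power mb); apply: xsG; rewrite inE eqxx.
have high2 : high_power x2.
  by apply: (gr_max_high_power mb); apply: xsG; rewrite !inE eqxx orbT.
(* The cocycle is lifted to a homogeneous [y]; as 𝔐^k kills x = d y, exactness puts 𝔐^k y inside L.
   It remains to see that [y] itself is torsion. *)
have [y' dy'] := (ex1 0%N x).1 dx0.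
have [y yn dy] : exists2 y : E 0%N, gpart n y & d 0%N y = x.
  by rewrite -dy'; apply: ghom_part => //; rewrite dy'.
have y_L s : ipow (rees_max a m) k s -> exists z, eps z = s *: y.
  move=> sk; apply/ex0; have [lin _] := d_hom 0%N.
  have [g gE] := linear_bundle lin; rewrite gE linearZ /= -gE dy; exact: tx.
exists y => //; split=> //.
(* The annihilator of [y] contains a power of 𝔐 once its radical contains the finitely many
   generators of 𝔐. *)
have Ji : @ideal (rees a) [set s | s *: y = 0].
  apply: submoduleI => [|s s1 s2 /= s1y s2y]; first by rewrite /= scale0r.
  by rewrite scalerDl -scalerA s1y s2y scaler0 addr0.
have [t tP t_gen] := rees_max_generators m_ideal a_ideal A_noeth.
have [|K KJ] := ipow_sub_of_radical t_gen Ji; last by exists K.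
move=> s /tP[[v mv ->]|[g ag ->]].
  exists k; apply: (degree0_kills eps_hom n_lt0 yn y_L _ _).
    by rewrite rees_monoX // mul0n; apply: rees_mono_part.
  by apply: ipowX; apply: rees_max_mono0.
exact: (degree1_power_kills m_ideal eps_hom eps_inj n_lt0 yn
  y_L F_dec F_top l_gt0 reg high1 high2 ag).
Qed.
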